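(* Let $m,n\ge1$ and $1\le k\le m$. Then for all families $(a_{\mathbf i})_{\mathbf i\in\mathcal M(m,n)}$ of complex numbers, $$\Big(\sum_{\mathbf i\in\mathcal M(m,n)}|a_{\mathbf i}|^{\frac{2m}{m+1}}\Big)^{\frac{m+1}{2m}}\le\prod_{S\in\mathcal P_k(m)}\Big(\sum_{\mathbf i_S}\Big(\sum_{\mathbf i_{\hat S}}|a_{\mathbf i}|^2\Big)^{\frac12\times\frac{2k}{k+1}}\Big)^{\frac{k+1}{2k}\times\frac1{\binom mk}}.$$
   Context: $\mathcal M(m,n)=\{\mathbf i=(i_1,\dots,i_m):\ i_1,\dots,i_m\in\{1,\dots,n\}\}$. $\mathcal P_k(m)$ is the set of subsets of $\{1,\dots,m\}$ of cardinality $k$. For $S=\{s_1<\dots<s_k\}\in\mathcal P_k(m)$, $\hat S$ is its complement in $\{1,\dots,m\}$ and $\mathbf i_S=(i_{s_1},\dots,i_{s_k})\in\mathcal M(k,n)$. The symbol $\sum_{\mathbf i_S}$ means $\sum_{i_{s_1}=1}^n\cdots\sum_{i_{s_k}=1}^n$, and $\sum_{\mathbf i_{\hat S}}$ is defined likewise, summing over the indices $i_j\in\{1,\dots,n\}$ with $j\in\hat S$ (when $\hat S=\emptyset$ the inner sum is just the single term $|a_{\mathbf i}|^2$). *)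

(* Defs.v *)
From HB Require Import structures.
From mathcomp Require Import all_boot all_order all_algebra.
From mathcomp Require Import complex.
From mathcomp Require Import reals exp.

Set Implicit Arguments.
Unset Strict Implicit.
Unset Printing Implicit Defensive.

Import Order.TTheory GRing.Theory Num.Theory.

Local Open Scope ring_scope.

(* M(m, n), with 0-based positions and values: {1..m} is 'I_m, {1..n} is
   'I_n. *)
Definition mindex (m n : nat) := {ffun 'I_m -> 'I_n}.

(* i_S: enum_val lists the elements of S : {set 'I_m} in increasing order, so
   the l-th entry is i_{s_l}. Taking #|S| as the length avoids a cast along
   #|S| = k. *)
Definition mrestr (m n : nat) (S : {set 'I_m}) (i : mindex m n) :
    mindex #|S| n :=
  [ffun l => i (enum_val l)].

Lemma in_compl (m : nat) (S : {set 'I_m}) (j : 'I_m) :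
  j \notin S -> j \in ~: S.
Proof. by rewrite inE. Qed.

(* The multi-index i with i_S = u and i_(~: S) = v, see mrestr_glue,
   mrestr_glueC and mglue_restr; enum_rank_in h j is the position of j in the
   increasing enumeration. *)
Definition mglue (m n : nat) (S : {set 'I_m})
    (u : mindex #|S| n) (v : mindex #|~: S| n) : mindex m n :=
  [ffun j => match boolP (j \in S) with
             | AltTrue h => u (enum_rank_in h j)
             | AltFalse h => v (enum_rank_in (in_compl h) j)
             end].

Lemma mrestr_glue (m n : nat) (S : {set 'I_m})
    (u : mindex #|S| n) (v : mindex #|~: S| n) :
  mrestr S (mglue u v) = u.
Proof.
apply/ffunP => l; rewrite !ffunE; case: {-}_ / boolP => h.
  by rewrite enum_valK_in.
by case/negP: h; exact: enum_valP.
Qed.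

Lemma mrestr_glueC (m n : nat) (S : {set 'I_m})
    (u : mindex #|S| n) (v : mindex #|~: S| n) :
  mrestr (~: S) (mglue u v) = v.
Proof.
apply/ffunP => l; rewrite !ffunE; case: {-}_ / boolP => h.
  by have := enum_valP l; rewrite inE h.
by rewrite enum_valK_in.
Qed.

Lemma mglue_restr (m n : nat) (S : {set 'I_m}) (i : mindex m n) :
  mglue (mrestr S i) (mrestr (~: S) i) = i.
Proof.
apply/ffunP => j; rewrite !ffunE; case: {-}_ / boolP => h.
  by rewrite ffunE enum_rankK_in.
by rewrite ffunE enum_rankK_in // inE.
Qed.

(* The modulus as an element of R; `|z| itself has type R[i]. *)
Definition cabs (R : realType) (z : R[i]) : R := ComplexField.Normc.normc z.

Lemma cabsE (R : realType) (z : R[i]) : `|z| = (cabs z)%:C%C.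
Proof. by []. Qed.

(* Main.v *)
Require Import Defs.
From HB Require Import structures.
From mathcomp Require Import all_boot all_order all_algebra.
From mathcomp Require Import complex ring.
From mathcomp Require Import reals sequences exp.

(** Both sides compare mixed norms of the modulus [F] of the family, in which
    each coordinate [j] of the multi-index is summed out with its own exponent.
    Put [p_k := 2k/(k+1) <= 2].

    The left-hand side is the norm with exponent [p_m] in every coordinate.  For
    a [k]-subset [S], let [q_S] be [p_k] on [S] and [2] off [S].  Exactly
    [C(m-1,k-1) = k C(m,k) / m] of the sets [S] contain a given coordinate, so
    the average over [S] of [1/q_S(j)] is [1/2 + 1/(2m) = 1/p_m] for every [j].
    Hoelder's inequality for [C(m,k)] functions, applied one coordinate at a
    time, therefore interpolates: the left-hand side is at most the geometric
    mean over [S] of the mixed norms with exponents [q_S], all with the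
    coordinates summed in the same order ([mixnorm_holder]).

    On the right-hand side the coordinates of [S] are instead all outermost.  By
    Minkowski's inequality, moving a larger exponent inside a smaller one can
    only increase a mixed norm ([pnorm_swap]), so the factor of [S] dominates
    the mixed norm with exponents [q_S] ([mixnorm_le]).

    All the norms are taken on the one type of multi-indices: summing out a
    coordinate gives a function that no longer depends on it, rather than a
    function of fewer indices.  Coordinates can then be permuted and grouped
    without any reindexing of types, and only the last step ([pnorm_mglue])
    returns to pairs of restricted multi-indices. *)

Import Order.TTheory GRing.Theory Num.Theory.

Set Implicit Arguments.
Unset Strict Implicit.
Unset Printing Implicit Defensive.

Local Open Scope ring_scope.

(** * Inequalities of Hoelder and Minkowski for finite sums *)

(** Nonnegative exponents make this valid for [x = 0] as well: their sum
    vanishes only if each of them does. *)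
Lemma powR_sum (R : realType) (I : finType) (P : pred I) (x : R) (t : I -> R) :
  (forall s, P s -> 0 <= t s) ->
  x `^ (\sum_(s | P s) t s) = \prod_(s | P s) x `^ t s.
Proof.
move=> t0; suff [] : x `^ (\sum_(s | P s) t s) = \prod_(s | P s) x `^ t s
    /\ 0 <= \sum_(s | P s) t s by [].
apply: (big_rec2 (fun y z => x `^ z = y /\ 0 <= z)) => [|s y z Ps [<- z0]].
  by rewrite powRr0.
split; last exact: addr_ge0 (t0 s Ps) z0.
have [x0|x0] := eqVneq x 0; last by rewrite powRD// x0 implybT.
have [ts0|ts0] := eqVneq (t s) 0; first by rewrite ts0 add0r powRr0 mul1r.
rewrite powRD//; apply/implyP; rewrite paddr_eq0 ?t0//.
by rewrite (negPf ts0).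
Qed.

Lemma powR_prod (R : realType) (I : finType) (P : pred I) (x : I -> R) (r : R) :
  (forall s, P s -> 0 <= x s) ->
  (\prod_(s | P s) x s) `^ r = \prod_(s | P s) x s `^ r.
Proof.
move=> x0; suff [] : (\prod_(s | P s) x s) `^ r = \prod_(s | P s) x s `^ r
    /\ 0 <= \prod_(s | P s) x s by [].
apply: (big_rec2 (fun y z => z `^ r = y /\ 0 <= z)) => [|s y z Ps [<- z0]].
  by rewrite powR1.
by split; [rewrite powRM ?x0 | rewrite mulr_ge0 ?x0].
Qed.

(** With [A] the weighted mean of the [x s], the bound [x <= A expR (x/A - 1)] is
    [1 + y <= expR y]; in the weighted product of these bounds the exponents
    [x s / A - 1] average to [0], which leaves [A]. *)
Lemma weighted_AGM (R : realType) (I : finType) (P : pred I) (x t : I -> R) :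
  (forall s, P s -> 0 <= t s) -> \sum_(s | P s) t s = 1 ->
  (forall s, P s -> 0 <= x s) ->
  \prod_(s | P s) x s `^ t s <= \sum_(s | P s) t s * x s.
Proof.
move=> t0 t1 x0; set A := \sum_(s | P s) _.
have tx0 s : P s -> 0 <= t s * x s by move=> Ps; rewrite mulr_ge0 ?t0 ?x0.
have A0 : 0 <= A by rewrite sumr_ge0.
have [A_eq0|A_neq0] := eqVneq A 0.
  (* Some weight is nonzero, and the corresponding factor vanishes. *)
  have [s Ps ts] : exists2 s, P s & t s != 0.
    apply/exists_inP; apply: contra_eqT t1 => /exists_inPn ts0.
    rewrite big1 1?eq_sym ?oner_eq0// => s Ps.
    by apply/eqP; move: (ts0 s Ps); rewrite negbK.
  have /eqP := psumr_eq0P tx0 A_eq0 Ps; rewrite mulf_eq0 (negPf ts)/= => /eqP xs.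
  by rewrite A_eq0 (bigD1 s)//= xs powR0// mul0r.
have -> : A = \prod_(s | P s) (A * expR (x s / A - 1)) `^ t s.
  transitivity (A `^ (\sum_(s | P s) t s) *
      expR (\sum_(s | P s) t s * (x s / A - 1))).
    rewrite t1 powRr1//; under eq_bigr do rewrite mulrBr mulr1 mulrA.
    by rewrite big_split/= sumrN t1 -mulr_suml divff// subrr expR0 mulr1.
  rewrite powR_sum// expR_sum -big_split/=; apply: eq_bigr => s Ps.
  by rewrite powRM ?expR_ge0// -expRM mulrC [in X in _ = X]mulrC [t s * _]mulrC.
apply: ler_prod => s Ps; rewrite powR_ge0/= ge0_ler_powR ?t0 ?nnegrE ?x0//.
  by rewrite mulr_ge0 ?expR_ge0.
rewrite -ler_pdivrMl ?lt_def ?A_neq0// mulrC.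
by apply: le_trans (expR_ge1Dx _); rewrite addrC subrK.
Qed.

(** After division of each [f s] by its sum [A s], this is [weighted_AGM]
    summed over [x].  Zero weights are allowed; the normalization is then
    harmless even where [A s = 0], since the factor is [1]. *)
Lemma holder_family (R : realType) (I J : finType) (P : pred I) (Q : pred J)
    (f : I -> J -> R) (t : I -> R) :
  (forall s, P s -> 0 <= t s) -> \sum_(s | P s) t s = 1 ->
  (forall s x, 0 <= f s x) ->
  \sum_(x | Q x) \prod_(s | P s) f s x `^ t s
    <= \prod_(s | P s) (\sum_(x | Q x) f s x) `^ t s.
Proof.
move=> t0 t1 f0; pose A s := \sum_(x | Q x) f s x.
have A0 s : 0 <= A s by apply: sumr_ge0.
(* If [A s = 0] with a nonzero weight, then [f s] vanishes and so does the
   left-hand side. *)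
have [/exists_inP[s Ps /andP[/eqP As ts]]|/exists_inPn AP] :=
    boolP [exists s in P, (A s == 0) && (t s != 0)].
  rewrite big1 => [|x Qx]; first by apply: prodr_ge0 => *; exact: powR_ge0.
  by rewrite (bigD1 s)//= (psumr_eq0P _ As Qx)// powR0// mul0r.
have split_f s x : P s -> f s x `^ t s = A s `^ t s * (f s x / A s) `^ t s.
  move=> Ps; have := AP s Ps; rewrite negb_and negbK => /orP[As|/eqP ->].
    by rewrite -powRM ?divr_ge0// mulrC divfK.
  by rewrite !powRr0 mulr1.
have -> : \sum_(x | Q x) \prod_(s | P s) f s x `^ t s
    = \sum_(x | Q x) (\prod_(s | P s) A s `^ t s)
                     * \prod_(s | P s) (f s x / A s) `^ t s.
  apply: eq_bigr => x _; rewrite -big_split/=.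
  by apply: eq_bigr => s; exact: split_f.
rewrite -mulr_sumr ler_piMr//; first by apply: prodr_ge0 => *; exact: powR_ge0.
apply: (@le_trans _ _ (\sum_(x | Q x) \sum_(s | P s) t s * (f s x / A s))).
  by apply: ler_sum => x _; apply: weighted_AGM => // s _; rewrite divr_ge0.
rewrite exchange_big/= -t1; apply: ler_sum => s Ps.
rewrite -mulr_sumr -mulr_suml -/(A s).
have := AP s Ps; rewrite negb_and negbK => /orP[As|/eqP ->].
  by rewrite divff// mulr1.
by rewrite mul0r.
Qed.

(** This is the triangle inequality in l^(1/t) for the vectors
    [x |-> c x u `^ t].  With [D u] the sum of [c] over [x], Hoelder's
    inequality with weights [t] and [1 - t] bounds, for each [x], the inner
    expression by a constant times a sum that is linear in [c x] once [D] is
    fixed; summation over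
    [x] then reproduces the sum of the [D u `^ t]. *)
Lemma minkowski_swap (R : realType) (I J : finType) (P : pred I) (Q : pred J)
    (c : I -> J -> R) (t : R) :
  0 < t -> t <= 1 -> (forall x u, 0 <= c x u) ->
  \sum_(x | P x) (\sum_(u | Q u) c x u `^ t) `^ t^-1
    <= (\sum_(u | Q u) (\sum_(x | P x) c x u) `^ t) `^ t^-1.
Proof.
move=> t0 t1 c0; pose D u := \sum_(x | P x) c x u.
have D0 u : 0 <= D u by apply: sumr_ge0.
rewrite -/D; set W := \sum_(u | Q u) D u `^ t.
have W0 : 0 <= W by apply: sumr_ge0 => u _; exact: powR_ge0.
have t_neq0 : t != 0 by rewrite gt_eqF.
have ti0 : 0 <= t^-1 by rewrite invr_ge0 ltW.
have holder x : P x -> (\sum_(u | Q u) c x u `^ t) `^ t^-1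
    <= (\sum_(u | Q u) c x u * D u `^ (t - 1)) * W `^ (t^-1 - 1).
  move=> Px.
  have split_c u : c x u `^ t
      = (c x u * D u `^ (t - 1)) `^ t * (D u `^ t) `^ (1 - t).
    rewrite powRM ?powR_ge0// -mulrA -!powRrM.
    (* [D u `^ (t - 1)] is no inverse of [D u `^ (1 - t)] when [D u = 0], but then
       [c x u = 0] too. *)
    have [Du|Du] := eqVneq (D u) 0.
      by rewrite (psumr_eq0P _ Du Px)// powR0// mul0r.
    rewrite -powRD ?Du ?implybT// (_ : _ + _ = 0) ?powRr0 ?mulr1//.
    by ring.
  pose f b u := if b then c x u * D u `^ (t - 1) else D u `^ t.
  pose w b := if b then t else 1 - t.
  have w0 b : predT b -> 0 <= w b by case: b => _; rewrite /w ?subr_ge0 ?(ltW t0).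
  have w1 : \sum_(b | predT b) w b = 1 by rewrite big_bool/= subrKC.
  have f0 b u : 0 <= f b u by case: b; rewrite /f ?mulr_ge0 ?powR_ge0.
  have hold : \sum_(u | Q u) c x u `^ t
      <= (\sum_(u | Q u) c x u * D u `^ (t - 1)) `^ t * W `^ (1 - t).
    have := holder_family Q w0 w1 f0; rewrite [leRHS]big_bool/=.
    by congr (_ <= _); apply: eq_bigr => u _; rewrite big_bool/= -split_c.
  have e0 : 0 <= \sum_(u | Q u) c x u * D u `^ (t - 1).
    by apply: sumr_ge0 => u _; exact: (f0 true).
  apply: (le_trans (ge0_ler_powR ti0 _ _ hold)).
  - by rewrite nnegrE sumr_ge0// => u _; exact: powR_ge0.
  - by rewrite nnegrE mulr_ge0 ?powR_ge0.
  rewrite powRM ?powR_ge0// -!powRrM divff// powRr1//.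
  by rewrite mulrBl divff// mul1r.
rewrite (le_trans (ler_sum _ holder))// -mulr_suml exchange_big/=.
under eq_bigr => u _ do rewrite -mulr_suml (mulr_powRB1 (D0 u) t0).
by rewrite -/W mulr_powRB1 ?invr_gt0.
Qed.

(** * Summation over a set of coordinates *)

Definition offeq (J X : finType) (A : {set J}) (i i' : {ffun J -> X}) : bool :=
  [forall j, (j \notin A) ==> (i' j == i j)].

Lemma offeqP (J X : finType) (A : {set J}) (i i' : {ffun J -> X}) :
  reflect (forall j, j \notin A -> i' j = i j) (offeq A i i').
Proof.
apply: (iffP forallP) => h j; first by move=> jA; apply/eqP/(implyP (h j)).
by apply/implyP => /h ->.
Qed.

Definition splice (J X : finType) (A : {set J}) (i w : {ffun J -> X}) :
    {ffun J -> X} :=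
  [ffun j => if j \in A then w j else i j].

Lemma offeq_set0 (J X : finType) (i : {ffun J -> X}) :
  offeq set0 i =1 pred1 i.
Proof.
move=> i' /=; apply/offeqP/eqP => [h|-> //].
by apply/ffunP => j; rewrite h// inE.
Qed.

Lemma sum_offeq_setT (V : nmodType) (J X : finType) (i : {ffun J -> X})
    (G : {ffun J -> X} -> V) :
  \sum_(w | offeq setT i w) G w = \sum_w G w.
Proof. by apply: eq_bigl => w; apply/offeqP => j; rewrite inE. Qed.

(** A multi-index [w] that agrees with [i] off [A :|: B] is reached through a
    unique intermediate one, namely [splice A i w]. *)
Lemma sum_offeqU (V : nmodType) (J X : finType) (A B : {set J})
    (i : {ffun J -> X}) (G : {ffun J -> X} -> V) :
  [disjoint A & B] ->
  \sum_(i' | offeq A i i') \sum_(w | offeq B i' w) G w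
    = \sum_(w | offeq (A :|: B) i w) G w.
Proof.
move=> dAB; have AB j : j \in A -> j \notin B by move/(disjointFr dAB)->.
rewrite (exchange_big_dep (offeq (A :|: B) i))/=.
  apply: eq_bigr => w /offeqP iw; rewrite (big_pred1 (splice A i w))// => i' /=.
  apply/andP/eqP => [[/offeqP ii' /offeqP i'w]|->].
    apply/ffunP => j; rewrite ffunE; case: ifPn => [/AB/i'w //|]; exact: ii'.
  split; apply/offeqP => j jA; rewrite ffunE.
    by rewrite (negPf jA).
  by case: ifPn => // jA'; rewrite iw// inE negb_or jA'.
move=> i' w /offeqP ii' /offeqP i'w; apply/offeqP => j.
by rewrite inE negb_or => /andP[/ii' <- /i'w].
Qed.

(** The range of summation can be based at any [i], so that nested sums
    over disjoint sets of coordinates get independent ranges. *)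
Lemma sum_offeq_splice (V : nmodType) (J X : finType) (B : {set J})
    (i u : {ffun J -> X}) (G : {ffun J -> X} -> V) :
  \sum_(w | offeq B u w) G w = \sum_(x | offeq B i x) G (splice B u x).
Proof.
rewrite (reindex_onto (splice B u) (splice B i)) => [|w /offeqP uw]; last first.
  by apply/ffunP => j; rewrite !ffunE; case: ifPn => [->|/uw].
apply: eq_bigl => x; apply/andP/offeqP => [[_ /eqP/ffunP h] j jB|ix].
  by have := h j; rewrite !ffunE (negPf jB).
split; first by apply/offeqP => j jB; rewrite ffunE (negPf jB).
by apply/eqP/ffunP => j; rewrite !ffunE; case: ifPn => [->|/ix].
Qed.

(** * Partial norms *)

(** The l^q norm in the coordinates of [A] only, the others being frozen at
    [i]; the result does not depend on the coordinates of [i] in [A]. *)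
Definition pnorm (R : realType) (J X : finType) (A : {set J}) (q : R)
    (F : {ffun J -> X} -> R) (i : {ffun J -> X}) : R :=
  (\sum_(w | offeq A i w) F w `^ q) `^ q^-1.

Lemma pnorm_ge0 (R : realType) (J X : finType) (A : {set J}) (q : R)
    (F : {ffun J -> X} -> R) i : 0 <= pnorm A q F i.
Proof. exact: powR_ge0. Qed.

Lemma sum_powR_ge0 (R : realType) (I : finType) (P : pred I) (q : R)
    (F : I -> R) : 0 <= \sum_(i | P i) F i `^ q.
Proof. by apply: sumr_ge0 => *; exact: powR_ge0. Qed.

Lemma eq_pnorm (R : realType) (J X : finType) (A : {set J}) (q : R)
    (F G : {ffun J -> X} -> R) : F =1 G -> pnorm A q F =1 pnorm A q G.
Proof. by move=> FG i; congr (_ `^ _); apply: eq_bigr => w _; rewrite FG. Qed.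

Lemma pnorm_powK (R : realType) (J X : finType) (A : {set J}) (q : R)
    (F : {ffun J -> X} -> R) i : q != 0 ->
  pnorm A q F i `^ q = \sum_(w | offeq A i w) F w `^ q.
Proof. by move=> q0; rewrite -powRrM mulVf// powRr1// sum_powR_ge0. Qed.

Lemma le_pnorm (R : realType) (J X : finType) (A : {set J}) (q : R)
    (F G : {ffun J -> X} -> R) : 0 < q ->
  (forall i, 0 <= F i) -> (forall i, F i <= G i) ->
  forall i, pnorm A q F i <= pnorm A q G i.
Proof.
move=> q0 F0 FG i.
apply: ge0_ler_powR; rewrite ?invr_ge0 ?nnegrE ?sum_powR_ge0 ?(ltW q0)//.
apply: ler_sum => w _; apply: ge0_ler_powR; rewrite ?nnegrE ?(ltW q0)//.
exact: le_trans (FG w).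
Qed.

Lemma pnorm_set0 (R : realType) (J X : finType) (q : R)
    (F : {ffun J -> X} -> R) i : q != 0 -> 0 <= F i -> pnorm set0 q F i = F i.
Proof.
move=> q0 Fi; rewrite /pnorm (big_pred1 i); last exact: offeq_set0.
by rewrite -powRrM divff// powRr1.
Qed.

Lemma pnormU (R : realType) (J X : finType) (A B : {set J}) (q : R)
    (F : {ffun J -> X} -> R) i : q != 0 -> [disjoint A & B] ->
  pnorm A q (pnorm B q F) i = pnorm (A :|: B) q F i.
Proof.
move=> q0 dAB; congr (_ `^ _); rewrite -sum_offeqU//.
by apply: eq_bigr => w _; rewrite pnorm_powK.
Qed.

(** This is [minkowski_swap] for [F `^ q] with the ratio [p / q] as exponent. *)
Lemma pnorm_swap (R : realType) (J X : finType) (A B : {set J}) (p q : R)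
    (F : {ffun J -> X} -> R) i :
  0 < p -> p <= q -> [disjoint A & B] ->
  pnorm B q (pnorm A p F) i <= pnorm A p (pnorm B q F) i.
Proof.
move=> p0 pq dAB; have q0 : 0 < q := lt_le_trans p0 pq.
have AB j : j \in A -> j \in B = false by exact: disjointFr.
(* [x] carries the coordinates of [B] and [u] those of [A]. *)
pose c (x u : {ffun J -> X}) := F (splice A x u) `^ q.
have t0 : 0 < p / q by rewrite divr_gt0.
have t1 : p / q <= 1 by rewrite ler_pdivrMr// mul1r.
have c0 x u : 0 <= c x u by exact: powR_ge0.
have ct x u : c x u `^ (p / q) = F (splice A x u) `^ p.
  by rewrite -powRrM mulrC divfK// gt_eqF.
have := minkowski_swap (offeq B i) (offeq A i) t0 t1 c0.
have -> : \sum_(x | offeq B i x) (\sum_(u | offeq A i u) c x u `^ (p / q))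
      `^ (p / q)^-1 = \sum_(x | offeq B i x) pnorm A p F x `^ q.
  apply: eq_bigr => x _; under eq_bigr do rewrite ct.
  rewrite -(sum_offeq_splice A i x (fun w => F w `^ p)) -powRrM.
  by rewrite invf_div mulrC.
have -> : \sum_(u | offeq A i u) (\sum_(x | offeq B i x) c x u) `^ (p / q)
    = \sum_(u | offeq A i u) pnorm B q F u `^ p.
  apply: eq_bigr => u /offeqP iu; rewrite -powRrM [q^-1 * p]mulrC; congr (_ `^ _).
  rewrite (sum_offeq_splice B i u); apply: eq_bigr => x /offeqP ix.
  congr (F _ `^ _); apply/ffunP => j; rewrite !ffunE.
  have [jA|jA] := boolP (j \in A); first by rewrite AB.
  by case: ifPn => // jB; rewrite ix// iu.
move=> h; have qi0 : 0 <= q^-1 by rewrite invr_ge0 ltW.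
apply: (le_trans (ge0_ler_powR qi0 _ _ h)).
- by rewrite nnegrE sum_powR_ge0.
- by rewrite nnegrE powR_ge0.
by rewrite -powRrM invf_div mulrAC divff ?gt_eqF// mul1r.
Qed.

(** The relation between the exponents says that the weights [t s / q s * p] to
    which Hoelder's inequality is applied sum to [1]. *)
Lemma pnorm_holder (R : realType) (J X I : finType) (P : pred I) (A : {set J})
    (t : I -> R) (q : I -> R) (p : R) (G : I -> {ffun J -> X} -> R) i :
  0 < p -> (forall s, P s -> 0 <= t s) -> (forall s, P s -> 0 < q s) ->
  \sum_(s | P s) t s / q s = p^-1 -> (forall s i, 0 <= G s i) ->
  pnorm A p (fun w => \prod_(s | P s) G s w `^ t s) i
    <= \prod_(s | P s) pnorm A (q s) (G s) i `^ t s.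
Proof.
move=> p0 t0 q0 tq G0.
have h0 s : P s -> 0 <= t s / q s * p.
  by move=> Ps; rewrite mulr_ge0 ?divr_ge0 ?t0 ?(ltW p0) ?(ltW (q0 s Ps)).
have h1 : \sum_(s | P s) t s / q s * p = 1.
  by rewrite -mulr_suml tq mulVf// gt_eqF.
have f0 s w : 0 <= G s w `^ q s by exact: powR_ge0.
have := holder_family (offeq A i) h0 h1 f0.
have -> : \sum_(w | offeq A i w) \prod_(s | P s) (G s w `^ q s) `^ (t s / q s * p)
   = \sum_(w | offeq A i w) (\prod_(s | P s) G s w `^ t s) `^ p.
  apply: eq_bigr => w _; rewrite powR_prod => [|s _]; last exact: powR_ge0.
  apply: eq_bigr => s Ps; rewrite -!powRrM; congr (_ `^ _).
  by field; rewrite gt_eqF ?q0.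
have pi0 : 0 <= p^-1 by rewrite invr_ge0 ltW.
move=> h; apply: (le_trans (ge0_ler_powR pi0 _ _ h)).
- by rewrite nnegrE sum_powR_ge0.
- by rewrite nnegrE prodr_ge0// => s _; exact: powR_ge0.
rewrite powR_prod => [|s _]; last exact: powR_ge0.
apply: ler_prod => s Ps; rewrite powR_ge0/= -!powRrM.
rewrite (_ : t s / q s * p / p = (q s)^-1 * t s)//.
by field; rewrite !gt_eqF ?q0.
Qed.

(** * Mixed norms *)

(** The head of [s] is the outermost coordinate. *)
Definition mixnorm (R : realType) (J X : finType) (s : seq J) (q : J -> R)
    (F : {ffun J -> X} -> R) : {ffun J -> X} -> R :=
  foldr (fun j => pnorm [set j] (q j)) F s.

Lemma mixnorm_ge0 (R : realType) (J X : finType) (s : seq J) (q : J -> R)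
    (F : {ffun J -> X} -> R) :
  (forall i, 0 <= F i) -> forall i, 0 <= mixnorm s q F i.
Proof. by move=> F0; case: s => //= j s i; exact: pnorm_ge0. Qed.

Lemma mixnorm_const (R : realType) (J X : finType) (s : seq J) (p : R)
    (F : {ffun J -> X} -> R) : uniq s -> 0 < p -> (forall i, 0 <= F i) ->
  mixnorm s (fun=> p) F =1 pnorm [set j in s] p F.
Proof.
move=> us p0 F0; have p_neq0 : p != 0 by rewrite gt_eqF.
elim: s us => [_ i|j s IH /andP[js us] i] /=.
  by rewrite set_nil pnorm_set0.
rewrite (eq_pnorm _ _ (IH us)) pnormU ?set_cons//.
by rewrite disjoints1 inE.
Qed.

(** Interpolation: [pnorm_holder] at each coordinate, from the innermost
    outwards. *)
Lemma mixnorm_holder (R : realType) (J X I : finType) (P : pred I) (s : seq J)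
    (t : I -> R) (q : I -> J -> R) (p : J -> R) (F : {ffun J -> X} -> R) :
  (forall j, 0 < p j) -> (forall e, P e -> 0 <= t e) ->
  \sum_(e | P e) t e = 1 -> (forall e j, P e -> 0 < q e j) ->
  (forall j, \sum_(e | P e) t e / q e j = (p j)^-1) -> (forall i, 0 <= F i) ->
  forall i, mixnorm s p F i <= \prod_(e | P e) mixnorm s (q e) F i `^ t e.
Proof.
move=> p0 t0 t1 q0 tq F0; elim: s => [|j s IH] i /=.
  by rewrite -powR_sum// t1 powRr1.
apply: le_trans (pnorm_holder _ _ (p0 j) t0 _ (tq j) _); last 2 first.
- by move=> e Pe; exact: q0.
- by move=> e w; exact: mixnorm_ge0.
by apply: le_pnorm => // w; exact: mixnorm_ge0.
Qed.

(** Going outwards, a coordinate of [S] joins the outer block directly; any other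
    one has to be moved inside that block, by [pnorm_swap], to join the
    inner block. *)
Lemma mixnorm_le (R : realType) (J X : finType) (s : seq J) (S : {set J})
    (p q : R) (F : {ffun J -> X} -> R) :
  uniq s -> 0 < p -> p <= q -> (forall i, 0 <= F i) ->
  forall i, mixnorm s (fun j => if j \in S then p else q) F i
    <= pnorm ([set j in s] :&: S) p (pnorm ([set j in s] :\: S) q F) i.
Proof.
move=> us p0 pq F0; have q0 : 0 < q := lt_le_trans p0 pq.
have p_neq0 : p != 0 by rewrite gt_eqF.
have q_neq0 : q != 0 by rewrite gt_eqF.
elim: s us => [_ i|j s IH /andP[js us] i] /=.
  by rewrite set_nil set0I set0D !pnorm_set0// pnorm_ge0.
rewrite set_cons setIUl setDUl.
have IHj r : 0 < r -> pnorm [set j] r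
      (mixnorm s (fun j => if j \in S then p else q) F) i
    <= pnorm [set j] r
        (pnorm ([set j in s] :&: S) p (pnorm ([set j in s] :\: S) q F)) i.
  by move=> r0; apply: le_pnorm => [//|w|w]; [exact: mixnorm_ge0|exact: IH].
have [jS|jS] := boolP (j \in S).
  have -> : [set j] :&: S = [set j] by apply/setIidPl; rewrite sub1set.
  have -> : [set j] :\: S = set0 by apply/eqP; rewrite setD_eq0 sub1set.
  apply: (le_trans (IHj p p0)).
  by rewrite set0U pnormU// disjoints1 !inE negb_and js.
have -> : [set j] :&: S = set0.
  by apply/eqP; rewrite setI_eq0 disjoints1.
have -> : [set j] :\: S = [set j].
  by apply/setDidPl; rewrite disjoints1.
apply: (le_trans (IHj q q0)); rewrite set0U.
apply: (le_trans (pnorm_swap _ _ p0 pq _)).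
  by rewrite disjoint_sym disjoints1 !inE negb_and js.
rewrite le_eqVlt; apply/orP; left; apply/eqP; apply: eq_pnorm => w.
by rewrite pnormU// disjoints1 !inE negb_and js orbT.
Qed.

(** * Subsets through a point *)

(** Pascal's rule: the sets avoiding [x] are the subsets of the complement of
    [x]. *)
Lemma card_draws_through (T : finType) (x : T) (k : nat) :
  #|[set S : {set T} | #|S| == k.+1 & x \in S]| = 'C(#|T|.-1, k).
Proof.
have cT : #|T| = #|T|.-1.+1 by rewrite prednK//; apply/card_gt0P; exists x.
have := card_draws T k.+1; rewrite [in RHS]cT binS.
rewrite -(cardsID [set S : {set T} | x \in S]) addnC.
have -> : [set S : {set T} | #|S| == k.+1] :\: [set S : {set T} | x \in S]
    = [set S : {set T} | S \subset [set~ x] & #|S| == k.+1].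
  apply/setP => S; rewrite !inE; congr (_ && _).
  by apply/idP/subsetP => [xS y yS|h]; [rewrite !inE; apply: contraNneq xS => <-|
    apply/negP => /h; rewrite !inE eqxx].
rewrite cards_draws cardsC1 => /addnI <-.
by congr #|pred_of_set _|; apply/setP => S; rewrite !inE.
Qed.

(** * Restriction and gluing of multi-indices *)

Lemma offeq_restr (m n : nat) (S : {set 'I_m}) (i w : mindex m n) :
  offeq (~: S) i w = (mrestr S w == mrestr S i).
Proof.
apply/offeqP/eqP => [h|/ffunP h j].
  by apply/ffunP => l; rewrite !ffunE h// inE negbK enum_valP.
rewrite inE negbK => jS; have := h (enum_rank_in jS j).
by rewrite !ffunE enum_rankK_in.
Qed.

Lemma sum_mglue_inner (V : nmodType) (m n : nat) (S : {set 'I_m})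
    (i : mindex m n) (G : mindex m n -> V) :
  \sum_(v : mindex #|~: S| n) G (mglue (mrestr S i) v)
    = \sum_(w | offeq (~: S) i w) G w.
Proof.
rewrite [RHS](reindex_onto (mglue (mrestr S i)) (mrestr (~: S))) => [|w] /=.
  by apply: eq_bigl => v; rewrite offeq_restr mrestr_glue mrestr_glueC !eqxx.
by rewrite offeq_restr => /eqP <-; exact: mglue_restr.
Qed.

Lemma offeq_restrC (m n : nat) (S : {set 'I_m}) (i w : mindex m n) :
  offeq S i w = (mrestr (~: S) w == mrestr (~: S) i).
Proof. by rewrite -offeq_restr setCK. Qed.

Lemma sum_mglue_outer (V : nmodType) (m n : nat) (S : {set 'I_m})
    (i : mindex m n) (G : mindex m n -> V) :
  \sum_(u : mindex #|S| n) G (mglue u (mrestr (~: S) i))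
    = \sum_(w | offeq S i w) G w.
Proof.
rewrite [RHS](reindex_onto (fun u => mglue u (mrestr (~: S) i)) (mrestr S))
  => [|w] /=.
  by apply: eq_bigl => v; rewrite offeq_restrC mrestr_glue mrestr_glueC !eqxx.
by rewrite offeq_restrC => /eqP <-; exact: mglue_restr.
Qed.

(** The value is independent of [i] because all coordinates are summed. *)
Lemma pnorm_mglue (R : realType) (m n : nat) (S : {set 'I_m}) (p q : R)
    (F : mindex m n -> R) (i : mindex m n) :
  pnorm S p (pnorm (~: S) q F) i
    = (\sum_(u : mindex #|S| n)
         (\sum_(v : mindex #|~: S| n) F (mglue u v) `^ q) `^ (q^-1 * p))
        `^ p^-1.
Proof.
congr (_ `^ _); rewrite -sum_mglue_outer; apply: eq_bigr => u _.
rewrite powRrM; congr ((_ `^ _) `^ _).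
by rewrite -sum_mglue_inner mrestr_glue.
Qed.

(** * The inequality *)

Theorem theorem2p1 (R : realType) (m n k : nat)
    (hm : (1 <= m)%N) (hn : (1 <= n)%N) (hk1 : (1 <= k)%N) (hkm : (k <= m)%N)
    (a : mindex m n -> R[i]) :
  (\sum_(i : mindex m n) cabs (a i) `^ (2 * m%:R / (m%:R + 1)))
     `^ ((m%:R + 1) / (2 * m%:R))
  <= \prod_(S : {set 'I_m} | #|S| == k)
       (\sum_(u : mindex #|S| n)
          (\sum_(v : mindex #|~: S| n) cabs (a (mglue u v)) ^+ 2)
            `^ (1 / 2 * (2 * k%:R / (k%:R + 1))))
         `^ ((k%:R + 1) / (2 * k%:R) * (1 / 'C(m, k)%:R)).
Proof.
pose F i : R := cabs (a i).
have F0 i : 0 <= F i.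
  by rewrite /F; case: (a i) => x y; rewrite /cabs /= sqrtr_ge0.
(* All the norms below involve every coordinate, so the base point is
   immaterial. *)
pose i0 : mindex m n := [ffun=> Ordinal hn].
have m0 : (0 : R) < m%:R by rewrite ltr0n.
have k0 : (0 : R) < k%:R by rewrite ltr0n.
have C0 : (0 : R) < 'C(m, k)%:R by rewrite ltr0n bin_gt0.
pose pm : R := 2 * m%:R / (m%:R + 1); pose pk : R := 2 * k%:R / (k%:R + 1).
have pm0 : 0 < pm by rewrite divr_gt0 ?mulr_gt0 ?addr_gt0.
have pk0 : 0 < pk by rewrite divr_gt0 ?mulr_gt0 ?addr_gt0.
have pk2 : pk <= 2 by rewrite ler_pdivrMr ?addr_gt0// ler_pM2l// lerDl.
pose q (S : {set 'I_m}) j : R := if j \in S then pk else 2.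
pose P := [pred S : {set 'I_m} | #|S| == k].
pose t (S : {set 'I_m}) : R := 1 / 'C(m, k)%:R.
have enumT : [set j in enum 'I_m] = setT by apply/setP => j; rewrite !inE mem_enum.
have cardP : #|P| = 'C(m, k).
  by have := card_draws 'I_m k; rewrite card_ord cardsE.
have t0 S : P S -> 0 <= t S by rewrite divr_ge0 ?ler0n.
have t1 : \sum_(S | P S) t S = 1.
  by rewrite /t sumr_const cardP -[LHS]mulr_natr divfK// gt_eqF.
have q0 S j : P S -> 0 < q S j by rewrite /q; case: ifP.
(* The interpolation condition at [j]: [1 / q S j] is [1/2], plus [1/(2k)] when [S]
   contains [j]. *)
have tq j : \sum_(S | P S) t S / q S j = pm^-1.
  have qE S : t S / q S j = t S / 2 + (j \in S)%:R / (2 * k%:R * 'C(m, k)%:R).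
    rewrite /t /q /pk; case: ifP => _ /=; last by rewrite mul0r addr0.
    by field; rewrite !gt_eqF ?addr_gt0.
  rewrite (eq_bigr _ (fun S _ => qE S)) big_split/= -mulr_suml t1 -mulr_suml -natr_sum.
  have -> : (\sum_(S : {set 'I_m} | #|S| == k) (j \in S) = 'C(m.-1, k.-1))%N.
    have := card_draws_through j k.-1; rewrite card_ord prednK// => <-.
    rewrite -sum1_card big_mkcond [RHS]big_mkcond/=; apply: eq_bigr => S _.
    by rewrite !inE; case: (#|S| == k); case: (j \in S).
  have diag : m%:R * 'C(m.-1, k.-1)%:R = k%:R * 'C(m, k)%:R :> R.
    by rewrite -!natrM -[in 'C(m, k)](prednK hm) -[in RHS](prednK hk1) mul_bin_diag !prednK.
  have -> : 'C(m.-1, k.-1)%:R = k%:R * 'C(m, k)%:R / m%:R :> R.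
    by rewrite -diag mulrC mulKf// gt_eqF.
  by rewrite /pm; field; rewrite !gt_eqF ?addr_gt0.
have -> : (\sum_i cabs (a i) `^ (2 * m%:R / (m%:R + 1)))
     `^ ((m%:R + 1) / (2 * m%:R)) = mixnorm (enum 'I_m) (fun=> pm) F i0.
  rewrite mixnorm_const ?enum_uniq// enumT /pnorm sum_offeq_setT.
  by rewrite /pm invf_div.
apply: (le_trans (mixnorm_holder _ (fun=> pm0) t0 t1 q0 tq F0 i0)).
apply: ler_prod => S PS; rewrite powR_ge0/=.
have -> : (\sum_(u : mindex #|S| n)
          (\sum_(v : mindex #|~: S| n) cabs (a (mglue u v)) ^+ 2)
            `^ (1 / 2 * (2 * k%:R / (k%:R + 1))))
         `^ ((k%:R + 1) / (2 * k%:R) * (1 / 'C(m, k)%:R))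
   = pnorm S pk (pnorm (~: S) 2 F) i0 `^ t S.
  rewrite pnorm_mglue -powRrM /pk invf_div; congr (_ `^ _).
  apply: eq_bigr => u _; rewrite div1r; congr (_ `^ _).
  by apply: eq_bigr => v _; rewrite powR_mulrn// F0.
apply: ge0_ler_powR; rewrite ?nnegrE ?t0//; first exact: mixnorm_ge0.
  exact: pnorm_ge0.
have := mixnorm_le S (enum_uniq 'I_m) pk0 pk2 F0 i0.
by rewrite enumT setTI setTD.
Qed.
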